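(* Let $A$ be an affinely convex closed subset of a proper convex domain $\Omega\subset\mathbb{R}^n$ and let $x\in\Omega\setminus A$. A point $y\in A$ is a nearest point in $A$ for $x$ (with respect to the Funk metric) if and only if either $F_\Omega(x,y)=0$, or there exists a hyperplane $\Pi\subset\mathbb{R}^n$ which contains $y$, which separates $A$ and $x$, and which is parallel to a support hyperplane $H$ for $\Omega$ at $a=a_\Omega(x,y)$.
   Context: A proper convex domain in $\mathbb{R}^n$ is a non-empty open convex subset $\Omega\neq\mathbb{R}^n$. View $\mathbb{R}^n$ as an affine chart of $\mathbb{RP}^n$ with hyperplane at infinity $H_\infty$. For $x\ne y$ in $\Omega$ let $R(x,y)=\{x+t(y-x): t\ge 0\}$; $a_\Omega(x,y)$ is the unique point of $R(x,y)\cap\partial\Omega$ if $R(x,y)\not\subset\Omega$, and the point at infinity of $R(x,y)$ if $R(x,y)\subset\Omega$. The Funk metric is $F_\Omega(x,x)=0$ and, for $x\neq y$ and $a=a_\Omega(x,y)$, $F_\Omega(x,y)=\log\frac{|x-a|}{|y-a|}$ if $a\notin H_\infty$ and $F_\Omega(x,y)=0$ if $a\in H_\infty$ (so when $F_\Omega(x,y)>0$ the point $a$ lies in $\partial\Omega\subset\mathbb{R}^n$). ''Closed'' means closed in $\Omega$. A point $y\in A$ is a nearest point in $A$ for $x$ if $F_\Omega(x,y)=\inf_{z\in A}F_\Omega(x,z)$. A support hyperplane for $\Omega$ at $a\in\partial\Omega$ is an affine hyperplane containing $a$ and disjoint from $\Omega$. A hyperplane $\Pi$ separates $A$ and $x$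 if $A$ is contained in one of the closed half-spaces bounded by $\Pi$ and $x$ in the other. *)

(* Defs.v *)
From mathcomp Require Import all_boot all_order all_algebra.
From mathcomp Require Import all_classical all_reals all_analysis.
Import Order.TTheory GRing.Theory Num.Theory numFieldNormedType.Exports.

Set Implicit Arguments.
Unset Strict Implicit.
Unset Printing Implicit Defensive.

Local Open Scope classical_set_scope.
Local Open Scope ring_scope.

(* Points of R^n are row vectors. The topology of 'rV[R]_n is the product
   topology; the norm `|_| provided by the library is the sup norm, so the
   Euclidean norm is defined here. *)
Definition dot (R : realType) (n : nat) (u v : 'rV[R]_n) : R :=
  (u *m v^T) 0 0.

Definition enorm (R : realType) (n : nat) (v : 'rV[R]_n) : R :=
  Num.sqrt (dot v v).

Definition boundary (T : topologicalType) (A : set T) : set T :=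
  closure A `\` interior A.

Definition proper_convex_domain (R : realType) (n : nat)
    (Omega : set 'rV[R]_n) : Prop :=
  [/\ Omega !=set0, open Omega, convex_set Omega & Omega <> setT].

Definition ray (R : realType) (n : nat) (x y : 'rV[R]_n) : set 'rV[R]_n :=
  [set x + t *: (y - x) | t in [set t : R | 0 <= t]].

(* RP^n as the disjoint union of the affine chart R^n and the hyperplane at
   infinity H_oo = P(R^n). The point of H_oo with direction v != 0 is given by
   the line R v, through the canonical matrix <<v>>%MS of its row space. *)
Inductive proj_point (R : realType) (n : nat) : Type :=
| Affine of 'rV[R]_n
| AtInfinity of 'M[R]_n.

(* Meaningful for x != y in Omega: the set given to xget is then a singleton. *)
Definition endpoint (R : realType) (n : nat) (Omega : set 'rV[R]_n)
    (x y : 'rV[R]_n) : proj_point R n :=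
  if `[< ray x y `<=` Omega >] then AtInfinity <<y - x>>%MS
  else Affine (xget 0 (ray x y `&` boundary Omega)).

Definition funk (R : realType) (n : nat) (Omega : set 'rV[R]_n)
    (x y : 'rV[R]_n) : R :=
  if x == y then 0
  else match endpoint Omega x y with
       | Affine a => ln (enorm (x - a) / enorm (y - a))
       | AtInfinity _ => 0
       end.

Definition nearest_point (R : realType) (n : nat) (Omega A : set 'rV[R]_n)
    (x y : 'rV[R]_n) : Prop :=
  A y /\ funk Omega x y = inf [set funk Omega x z | z in A].

Definition hplane (R : realType) (n : nat) (u : 'rV[R]_n) (c : R) :
    set 'rV[R]_n := [set z | dot u z = c].

Definition is_hyperplane (R : realType) (n : nat) (P : set 'rV[R]_n) : Prop :=
  exists (u : 'rV[R]_n) (c : R), u != 0 /\ P = hplane u c.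

(* Replacing (u, c) by (- u, - c) exchanges the two closed half-spaces, so no
   generality is lost by fixing on which side A lies. *)
Definition separates (R : realType) (n : nat) (P A : set 'rV[R]_n)
    (x : 'rV[R]_n) : Prop :=
  exists (u : 'rV[R]_n) (c : R),
    [/\ u != 0, P = hplane u c, A `<=` [set z | dot u z <= c]
      & c <= dot u x].

Definition support_hyperplane (R : realType) (n : nat)
    (Omega H : set 'rV[R]_n) (a : 'rV[R]_n) : Prop :=
  [/\ boundary Omega a, is_hyperplane H, H a & H `&` Omega = set0].

Definition parallel (R : realType) (n : nat) (P Q : set 'rV[R]_n) : Prop :=
  exists v : 'rV[R]_n, Q = [set z + v | z in P].

(* Main.v *)
Require Import Defs.
From mathcomp Require Import all_boot all_order all_algebra.
From mathcomp Require Import all_classical all_reals all_analysis.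
Import Order.TTheory GRing.Theory Num.Theory numFieldNormedType.Exports.
From mathcomp Require Import ring lra.
Local Open Scope classical_set_scope.
Local Open Scope ring_scope.

(** Along the ray from x through y the domain is left at the endpoint
a = x + s (y - x) with s > 1, and then F(x, y) = ln (s / (s - 1)), which
decreases with s; if the ray never leaves the domain, F(x, y) = 0, the least
possible value. So a point y with F(x, y) = 0 is nearest. If F(x, y) > 0, then
for z in A the inequality F(x, y) <= F(x, z) holds exactly when the point
x + s (z - x) lies outside the domain (funk_le_homothety). Hence y is nearest
if and only if the image B of A under the homothety of centre x and ratio s is
disjoint from the domain.

If so, a hyperplane separates the open convex domain from the convex set B
(open_convex_separation). Since a belongs to B and to the boundary of the
domain, the parallel hyperplane H through a supports the domain, and B lies in
the closed half-space of H opposite to the domain. The inverse homothety takes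
H to a parallel hyperplane through y, with A on one side of it and x on the
other (nearest_point_parallel_support).

Conversely, let H support the domain at a, and let a parallel hyperplane
through y separate A from x. The homothety takes this hyperplane to H, so every
point of B lies on H or on the side of H that does not contain x. The domain is
convex, contains x and misses H, so it misses B too
(parallel_support_nearest_point).

The separation theorem is obtained by induction on the dimension, from the
one-dimensional completeness of the reals alone (weak_separation0). *)

(** * Segments, lines and the scalar product *)

(** Convexity in terms of the parametrised segment from x to y, the form in
which the Funk metric is expressed. *)
Lemma convex_set_segment {R : realType} {n : nat} {C : set 'rV[R]_n} :
  convex_set C <->
  forall x y (t : R), C x -> C y -> 0 <= t <= 1 -> C (x + t *: (y - x)).
Proof.
have convE (x y : 'rV[R]_n) (t : R) :
    x + t *: (y - x) = t *: y + (1 - t) *: x.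
  by apply/rowP => i; rewrite !mxE; ring.
split=> [cC x y t Cx Cy t01 | cC x y t xC yC].
  have := cC y x (Itv01 (proj1 (andP t01)) (proj2 (andP t01))).
  by rewrite !inE convE => /(_ Cy Cx).
move: xC yC; rewrite !inE => Cx Cy.
suff -> : conv t x y = y + t%:num *: (x - y) by apply: cC; rewrite ?ge0 ?le1.
by rewrite convE.
Qed.

Lemma dotE {R : realType} {n : nat} (u v : 'rV[R]_n) :
  dot u v = \sum_i u 0 i * v 0 i.
Proof. by rewrite /dot mxE; apply: eq_bigr => i _; rewrite mxE. Qed.

Lemma dotDr {R : realType} {n : nat} (u v w : 'rV[R]_n) :
  dot u (v + w) = dot u v + dot u w.
Proof. by rewrite /dot linearD mulmxDr mxE. Qed.

Lemma dotZr {R : realType} {n : nat} (u v : 'rV[R]_n) (t : R) :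
  dot u (t *: v) = t * dot u v.
Proof. by rewrite /dot linearZ -scalemxAr mxE. Qed.

Lemma dotBr {R : realType} {n : nat} (u v w : 'rV[R]_n) :
  dot u (v - w) = dot u v - dot u w.
Proof. by rewrite dotDr -scaleN1r dotZr mulN1r. Qed.

Lemma dot_line {R : realType} {n : nat} (u x y : 'rV[R]_n) (t : R) :
  dot u (x + t *: (y - x)) = dot u x + t * (dot u y - dot u x).
Proof. by rewrite dotDr dotZr dotBr. Qed.

Lemma dot_self_ge0 {R : realType} {n : nat} (v : 'rV[R]_n) : 0 <= dot v v.
Proof. by rewrite dotE sumr_ge0 // => i _; rewrite -expr2 sqr_ge0. Qed.

Lemma dot_self_gt0 {R : realType} {n : nat} (v : 'rV[R]_n) :
  v != 0 -> 0 < dot v v.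
Proof.
move=> v0; rewrite lt_neqAle dot_self_ge0 andbT eq_sym.
apply: contra v0; rewrite dotE psumr_eq0; last first.
  by move=> i _; rewrite -expr2 sqr_ge0.
move=> /allP v0; apply/eqP/rowP => i; rewrite mxE.
by apply/eqP; rewrite -sqrf_eq0 expr2; exact: v0 (mem_index_enum i).
Qed.

Lemma enorm_gt0 {R : realType} {n : nat} (v : 'rV[R]_n) :
  v != 0 -> 0 < enorm v.
Proof. by move=> /dot_self_gt0 v0; rewrite /enorm sqrtr_gt0. Qed.

Lemma enormZ {R : realType} {n : nat} (t : R) (v : 'rV[R]_n) :
  enorm (t *: v) = `|t| * enorm v.
Proof.
rewrite /enorm (_ : dot _ _ = t ^+ 2 * dot v v); last first.
  by rewrite !dotE mulr_sumr; apply: eq_bigr => i _; rewrite !mxE; ring.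
by rewrite sqrtrM ?sqr_ge0 // sqrtr_sqr.
Qed.

(** * Separation of convex sets *)

(** The scalar product, with the first coordinate set apart. *)
Lemma dot_row_mx {R : realType} {n : nat} (l : R) (u : 'rV[R]_n)
    (w : 'rV[R]_n.+1) :
  dot (row_mx l%:M u : 'rV[R]_(1 + n)) w
    = l * w 0 0 + dot u (rsubmx (w : 'rV[R]_(1 + n))).
Proof.
rewrite !dotE big_ord_recl; congr (_ + _).
  congr (_ * _); have -> : ord0 = lshift n (ord0 : 'I_1) by apply/val_inj.
  by rewrite row_mxEl mxE.
apply: eq_bigr => i _; rewrite [rsubmx _ _ _]mxE.
have -> : lift ord0 i = rshift 1 i by apply/val_inj.
by rewrite row_mxEr.
Qed.

(** A nonempty convex set that misses the origin lies in a closed linear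
half-space. No topological hypothesis is needed. In the inductive step, the slice w 0 0 = 0
lies in a half-space given by a vector of the smaller dimension; it remains to
find the coefficient of the first coordinate. *)
Lemma weak_separation0 {R : realType} {n : nat} {C : set 'rV[R]_n} :
  convex_set C -> C !=set0 -> ~ C 0 ->
  exists2 u : 'rV[R]_n, u != 0 & forall w, C w -> 0 <= dot u w.
Proof.
rewrite convex_set_segment.
elim: n C => [|n IHn] C cC [w0 Cw0] C0.
  by case: C0; rewrite (_ : 0 = w0) //; apply/rowP; case.
pose tail (w : 'rV[R]_n.+1) : 'rV[R]_n := rsubmx (w : 'rV[R]_(1 + n)).
pose cons (l : R) (v : 'rV[R]_n) : 'rV[R]_n.+1 := row_mx l%:M v : 'rV[R]_(1 + n).
have consK (w : 'rV[R]_n.+1) : cons (w 0 0) (tail w) = w.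
  have w0E : (w 0 0)%:M = lsubmx (w : 'rV[R]_(1 + n)).
    apply/matrixP => i j; rewrite [LHS]mxE [RHS]mxE !ord1 eqxx mulr1n.
    by congr (w _ _); apply/val_inj.
  by rewrite /cons w0E; exact (@hsubmxK R 1 1 n w).
have dot0 (v : 'rV[R]_n) : dot 0 v = 0 by rewrite /dot mul0mx mxE.
have cons_neq0 l v : (l != 0) || (v != 0) -> cons l v != 0.
  move=> lv; apply/eqP => /(congr1 (fun w : 'rV[R]_(1 + n) =>
    (w 0 (lshift n 0), rsubmx w))).
  rewrite /cons row_mxEl row_mxKr !mxE eqxx mulr1n => -[l0 v0].
  by move: lv; rewrite l0 v0 linear0 !eqxx.
have [nneg|/existsNP[w1 /not_implyP[Cw1 w1lt0]]] :=
    pselect (forall w, C w -> 0 <= w 0 0).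
  exists (cons 1 0) => [|w Cw]; first by rewrite cons_neq0 ?oner_eq0.
  by rewrite dot_row_mx dot0 addr0 mul1r nneg.
have [npos|/existsNP[w2 /not_implyP[Cw2 w2gt0]]] :=
    pselect (forall w, C w -> w 0 0 <= 0).
  exists (cons (-1) 0) => [|w Cw]; first by rewrite cons_neq0 ?oppr_eq0 ?oner_eq0.
  by rewrite dot_row_mx dot0 addr0 mulN1r oppr_ge0 npos.
move: w1lt0 w2gt0 => /negP; rewrite -ltNge => w1lt0 /negP; rewrite -ltNge => w2gt0.
(* The slice of C by the hyperplane on which the first coordinate vanishes. *)
pose C' : set 'rV[R]_n := [set v | C (cons 0 v)].
have cross (w w' : 'rV[R]_n.+1) : C w -> C w' -> w 0 0 < 0 -> 0 < w' 0 0 ->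
    let t := - w 0 0 / (w' 0 0 - w 0 0) in C' (tail (w + t *: (w' - w))).
  move=> Cw Cw' wlt0 w'gt0 t; rewrite /C' /=.
  have d0 : 0 < w' 0 0 - w 0 0 by lra.
  set p := w + _; suff p0 : p 0 0 = 0.
    rewrite -p0 consK; apply: cC => //; apply/andP; split.
      by rewrite divr_ge0 //; lra.
    by rewrite ler_pdivrMr //; lra.
  by rewrite /p !mxE /t; field; lra.
have cC' : forall v v' (t : R), C' v -> C' v' -> 0 <= t <= 1 ->
    C' (v + t *: (v' - v)).
  move=> v v' t Cv Cv' t01; rewrite /C' /=.
  suff -> : cons 0 (v + t *: (v' - v)) = cons 0 v + t *: (cons 0 v' - cons 0 v).
    exact: cC.
  have : (row_mx 0%:M (v + t *: (v' - v)) : 'rV[R]_(1 + n))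
      = row_mx 0%:M v + t *: (row_mx 0%:M v' - row_mx 0%:M v).
    by rewrite opp_row_mx add_row_mx scale_row_mx add_row_mx subrr scaler0 addr0.
  exact.
have [||u u0 uC'] := IHn C' cC'.
- by eexists; exact: cross Cw1 Cw2 w1lt0 w2gt0.
- rewrite /C' /= (_ : cons 0 0 = 0) // /cons; apply/eqP.
  by rewrite (_ : 0%:M = 0) ?row_mx0 //; apply/matrixP=> i j; rewrite !mxE mul0rn.
pose f w := dot u (tail w).
(* In the plane of the coordinates (w 0 0, f w), the points of C to the left of
   the vertical axis have smaller slopes than those to its right; a slope m in
   between makes f w - m * w 0 0 nonnegative on C. *)
have slope (w w' : 'rV[R]_n.+1) : C w -> C w' -> w 0 0 < 0 -> 0 < w' 0 0 ->
    f w / w 0 0 <= f w' / w' 0 0.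
  move=> Cw Cw' wlt0 w'gt0; have := uC' _ (cross _ _ Cw Cw' wlt0 w'gt0).
  rewrite /tail linearD linearZ linearB /= dot_line -/(tail w) -/(tail w').
  rewrite -/(f w) -/(f w') => fge0.
  have d0 : 0 < w' 0 0 - w 0 0 by lra.
  have := mulr_ge0 (ltW d0) fge0.
  have -> : (w' 0 0 - w 0 0) *
    (f w + - w 0 0 / (w' 0 0 - w 0 0) * (f w' - f w))
    = w' 0 0 * f w - w 0 0 * f w' by field; lra.
  move=> h; rewrite ler_ndivrMr // mulrAC ler_pdivrMr //; lra.
pose S := [set f w / w 0 0 | w in [set w | C w /\ w 0 0 < 0]].
have Sub : has_ubound S.
  by exists (f w2 / w2 0 0) => _ [w [Cw wlt0] <-]; exact: slope.
exists (cons (- sup S) u) => [|w Cw]; first by rewrite cons_neq0 ?u0 ?orbT.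
rewrite dot_row_mx -/(tail w) -/(f w).
have [wlt0|wgt0|w0E] := ltgtP (w 0 0) 0.
- have : f w / w 0 0 <= sup S by apply: ub_le_sup => //; exists w.
  by rewrite ler_ndivrMr //; lra.
- have : sup S <= f w / w 0 0.
    apply: ge_sup; first by exists (f w1 / w1 0 0), w1.
    by move=> _ [w' [Cw' w'lt0] <-]; exact: slope.
  by rewrite ler_pdivlMr //; lra.
- rewrite w0E mulr0 add0r; apply: uC'.
  by rewrite /C' /= -w0E consK.
Qed.

Lemma cvg_line {R : realType} {n : nat} (p v : 'rV[R]_n) (s : R) :
  (fun t : R => p + t *: v) @ s --> p + s *: v.
Proof.
by apply: cvgD; [exact: cvg_cst | apply: cvgZ; [exact: cvg_id | exact: cvg_cst]].
Qed.

Lemma open_line {R : realType} {n : nat} {O : set 'rV[R]_n} {p : 'rV[R]_n}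
    (v : 'rV[R]_n) :
  open O -> O p -> exists2 e : R, 0 < e & forall t, `|t| < e -> O (p + t *: v).
Proof.
move=> oO Op.
have := @cvg_line _ _ p v 0; rewrite scale0r addr0 => cv.
have /nbhs_ballP[e e0 He] := cv _ (open_nbhs_nbhs (conj oO Op)).
exists e => // t te; apply: He.
by rewrite -ball_normE /= sub0r normrN.
Qed.

(** The half-open segment from a point of a convex open set to a point of its
closure stays in the set. *)
Lemma closure_segment {R : realType} {n : nat} {O : set 'rV[R]_n}
    {x c : 'rV[R]_n} {l : R} :
  convex_set O -> open O -> O x -> closure O c -> 0 <= l < 1 ->
  O (x + l *: (c - x)).
Proof.
move=> /convex_set_segment cO oO Ox Oc /andP[l0 l1].
set y := x + _.
have l1' : 1 - l != 0 by lra.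
(* For c' near c, the point z c' for which y divides [z c', c'] in the same
   ratio as [x, c] is near x. *)
pose z (c' : 'rV[R]_n) := (1 - l)^-1 *: (y - l *: c').
have zc : z c = x.
  by apply/rowP => i; rewrite !mxE; field.
have cz : z @ c --> x.
  rewrite -[X in _ --> X]zc; apply: (@cvgZl_tmp _ _ _ (nbhs c)).
  apply: (@cvgB _ _ _ (nbhs c) _ (fun=> y) (fun c' => l *: c')).
    exact: cvg_cst.
  by apply: (@cvgZl_tmp _ _ _ (nbhs c)); exact: cvg_id.
have [c' [Oc' Ozc']] := Oc _ (cz _ (open_nbhs_nbhs (conj oO Ox))).
have -> : y = z c' + l *: (c' - z c').
  by apply/rowP => i; rewrite !mxE; field.
by apply: cO => //; rewrite l0 ltW.
Qed.

(** The separation of the origin from the difference set O - B; openness of O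
makes the inequality strict. *)
Lemma open_convex_separation {R : realType} {n : nat} {O B : set 'rV[R]_n} :
  open O -> convex_set O -> convex_set B -> O !=set0 -> B !=set0 ->
  O `&` B = set0 ->
  exists2 u : 'rV[R]_n, u != 0 & forall w b, O w -> B b -> dot u b < dot u w.
Proof.
move=> oO /convex_set_segment cO /convex_set_segment cB [w0 Ow0] [b0 Bb0] OB0.
pose C := [set wb.1 - wb.2 | wb in O `*` B].
have [| | |u u0 uC] := @weak_separation0 _ _ C.
- apply/convex_set_segment => _ _ t [[w b] [/= Ow Bb] <-] [[w' b'] [/= Ow' Bb'] <-] t01.
  exists (w + t *: (w' - w), b + t *: (b' - b)); first by split; [exact: cO|exact: cB].
  by apply/rowP => i; rewrite !mxE; ring.
- by exists (w0 - b0), (w0, b0).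
- move=> [[w b] [/= Ow Bb] /eqP]; rewrite subr_eq0 => /eqP wb.
  by have : (O `&` B) w by [split; rewrite // wb]; rewrite OB0.
exists u => // w b Ow Bb.
(* Moving w slightly in the direction - u decreases dot u w. *)
have [e e0 He] := open_line u oO Ow.
have Cwb : C (w + - (e / 2) *: u - b).
  exists (w + - (e / 2) *: u, b) => //; split => //=.
  by apply: He; rewrite normrN ger0_norm; lra.
have := uC _ Cwb; rewrite dotBr dotDr dotZr.
have : 0 < e / 2 * dot u u by rewrite mulr_gt0 ?dot_self_gt0 //; lra.
lra.
Qed.

(** * The endpoint of a ray and the Funk metric *)

(** Along the ray from x through y, a convex open set is left at a single
parameter s, greater than 1, which gives the endpoint; otherwise the ray never
leaves the set. *)
Lemma endpointP {R : realType} {n : nat} {O : set 'rV[R]_n} {x y : 'rV[R]_n} :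
  convex_set O -> open O -> O x -> O y -> x != y ->
  (endpoint O x y = AtInfinity <<y - x>>%MS
     /\ forall t, 0 <= t -> O (x + t *: (y - x)))
  \/ exists s : R, [/\ 1 < s, endpoint O x y = Affine (x + s *: (y - x)),
       boundary O (x + s *: (y - x))
       & forall t, 0 <= t -> O (x + t *: (y - x)) <-> t < s].
Proof.
move=> cO oO Ox Oy xy; rewrite /endpoint.
case: asboolP => [rO|nrO]; [left|right].
  by split=> // t t0; apply: rO; exists t.
pose p (t : R) := x + t *: (y - x).
have p0 : p 0 = x by rewrite /p scale0r addr0.
have p1 : p 1 = y by rewrite /p scale1r addrC subrK.
have pshift (t e : R) : p t + e *: (y - x) = p (t + e).
  by rewrite /p scalerDl addrA.
have pseg (t l : R) : x + l *: (p t - x) = p (l * t).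
  by rewrite /p addrAC subrr add0r scalerA.
(* The parameters of the points of the ray in O, with supremum s. *)
pose S := [set t : R | 0 <= t /\ O (p t)].
have Sdown t t' : 0 <= t' <= t -> O (p t) -> O (p t').
  move=> /andP[t'0 t't] Ot.
  have [t0|t0] := eqVneq t 0; first by rewrite (_ : t' = t) //; lra.
  rewrite -(divfK t0 t') -pseg.
  move/convex_set_segment : cO; apply => //.
  have t_gt0 : 0 < t by lra.
  apply/andP; split; first by rewrite divr_ge0 // ltW.
  by rewrite ler_pdivrMr // mul1r.
have Sopen t : 0 <= t -> O (p t) -> exists2 t', t < t' & S t'.
  move=> t0 Ot; have [e e0 He] := open_line (y - x) oO Ot.
  exists (t + e / 2); first lra.
  split; first lra.
  by rewrite -pshift; apply: He; rewrite ger0_norm; lra.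
have [t1 [t10 Ot1]] : exists t, 0 <= t /\ ~ O (p t).
  apply: contrapT => h; apply: nrO => _ [t /= t0 <-].
  by apply: contrapT => nO; apply: h; exists t.
have St1 : ubound S t1.
  move=> t [t0 Ot]; rewrite leNgt; apply/negP => t1t; apply: Ot1.
  by apply: Sdown Ot; rewrite t10 ltW.
have Sub : has_ubound S by exists t1.
have S1 : S 1 by split; rewrite ?p1.
have S0 : S !=set0 by exists 1.
pose s := sup S.
have Ss t : 0 <= t -> O (p t) <-> t < s.
  move=> t0; split=> [Ot|ts].
    have [t' tt' St'] := Sopen t t0 Ot.
    by apply: (lt_le_trans tt'); exact: ub_le_sup.
  have [t' [t'0 Ot'] tt'] := sup_gt S0 ts.
  by apply: Sdown Ot'; rewrite t0 ltW.
have s1 : 1 < s by apply/(Ss 1); rewrite ?p1.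
have bE t : 0 <= t -> boundary O (p t) <-> t = s.
  move=> t0; rewrite /boundary (proj1 (interior_id O) oO); split=> [[ct nOt]|->].
    have st : s <= t by rewrite leNgt; apply/negP => /Ss-/(_ t0).
    apply/eqP; rewrite eq_le st andbT leNgt; apply/negP => st'.
    have t_gt0 : 0 < t by lra.
    (* A closure point of parameter t > s would put the point of parameter
       (s + t) / 2 in O. *)
    have : O (p ((s + t) / 2)).
      rewrite -(divfK (lt0r_neq0 t_gt0) ((s + t) / 2)) -pseg; apply: closure_segment => //.
      apply/andP; split; first by rewrite divr_ge0 //; lra.
      by rewrite ltr_pdivrMr //; lra.
    by rewrite Ss; lra.
  split; last by rewrite Ss ?ltxx //; lra.
  move=> N Ns.
  have /nbhs_ballP[e e0 He] := @cvg_line _ _ x (y - x) s _ Ns.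
  have [r [r0 Or] rs] := sup_adherent e0 (conj S0 Sub).
  exists (p r); split=> //; apply: He; rewrite -ball_normE /=.
  have rs' := proj1 (Ss r r0) Or; rewrite -/s in rs.
  by rewrite ger0_norm; lra.
have s0 : 0 <= s by lra.
exists s; split=> //; last exact/bE.
congr (Affine _); apply: xget_subset1.
  by split; [exists s|exact/bE].
by move=> _ _ [[t t0 <-] /bE -> //] [[t' t'0 <-] /bE -> //].
Qed.

(** With a = x + s (y - x) the quotient of the distances from x and y to a is
s / (s - 1), written in a form that visibly decreases with s. *)
Lemma funk_affine {R : realType} {n : nat} {O : set 'rV[R]_n}
    {x y : 'rV[R]_n} {s : R} :
  x != y -> 1 < s -> endpoint O x y = Affine (x + s *: (y - x)) ->
  funk O x y = ln (1 + (s - 1)^-1).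
Proof.
move=> xy s1 eE; rewrite /funk (negbTE xy) eE; congr ln.
have -> : x - (x + s *: (y - x)) = (- s) *: (y - x).
  by apply/rowP => i; rewrite !mxE; ring.
have -> : y - (x + s *: (y - x)) = (1 - s) *: (y - x).
  by apply/rowP => i; rewrite !mxE; ring.
have N0 : 0 < enorm (y - x) by rewrite enorm_gt0 // subr_eq0 eq_sym.
have -> : enorm ((- s) *: (y - x)) = s * enorm (y - x).
  by rewrite enormZ normrN ger0_norm //; lra.
have -> : enorm ((1 - s) *: (y - x)) = (s - 1) * enorm (y - x).
  by rewrite enormZ ler0_norm ?opprB //; lra.
by field; rewrite gt_eqF //=; lra.
Qed.

Lemma funk_ge0 {R : realType} {n : nat} {O : set 'rV[R]_n}
    {x y : 'rV[R]_n} :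
  convex_set O -> open O -> O x -> O y -> 0 <= funk O x y.
Proof.
move=> cO oO Ox Oy; have [->|xy] := eqVneq x y; first by rewrite /funk eqxx.
have [[e _]|[s [s1 e _ _]]] := endpointP cO oO Ox Oy xy.
  by rewrite /funk (negbTE xy) e.
by rewrite (funk_affine xy s1 e) ln_ge0 // lerDl invr_ge0; lra.
Qed.

(** The Funk metric is nonnegative, so the infimum over A is a genuine greatest
lower bound. *)
Lemma nearest_pointP {R : realType} {n : nat} {O A : set 'rV[R]_n}
    {x y : 'rV[R]_n} :
  convex_set O -> open O -> A `<=` O -> O x -> A y ->
  nearest_point O A x y <-> forall z, A z -> funk O x y <= funk O x z.
Proof.
move=> cO oO AO Ox Ay; rewrite /nearest_point.
have lb : has_lbound [set funk O x z | z in A].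
  by exists 0 => _ [z Az <-]; apply: funk_ge0 => //; exact: AO.
split=> [[_ ->] z Az|h].
  by apply: ge_inf => //; exists z.
split=> //; apply/eqP; rewrite eq_le; apply/andP; split.
  apply: lb_le_inf; first by exists (funk O x y), y.
  by move=> _ [z Az <-]; exact: h.
by apply: ge_inf => //; exists y.
Qed.

(** The comparison of Funk distances from x reduces to a membership: y is at
most as far as z exactly when the homothety of centre x that maps y to the
endpoint of its ray maps z outside the domain. *)
Lemma funk_le_homothety {R : realType} {n : nat} {O : set 'rV[R]_n}
    {x y z : 'rV[R]_n} {s : R} :
  convex_set O -> open O -> O x -> O z -> x != y -> x != z -> 1 < s ->
  endpoint O x y = Affine (x + s *: (y - x)) ->
  funk O x y <= funk O x z <-> ~ O (x + s *: (z - x)).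
Proof.
move=> cO oO Ox Oz xy xz s1 yE; rewrite (funk_affine xy s1 yE).
have [[zE zO]|[s' [s'1 zE _ zO]]] := endpointP cO oO Ox Oz xz.
  rewrite /funk (negbTE xz) zE; split=> [|[]]; last by apply: zO; lra.
  by rewrite leNgt ln_gt0 // ltrDl invr_gt0; lra.
have inv_gt0 (r : R) : 1 < r -> 0 < (r - 1)^-1 by rewrite invr_gt0; lra.
rewrite (funk_affine xz s'1 zE) zO; last lra.
have /= -> := @ler_ln R (1 + (s - 1)^-1) (1 + (s' - 1)^-1).
- rewrite lerD2l lef_pV2 ?posrE ?subr_gt0 // lerD2r leNgt.
  by split=> /negP.
- by rewrite posrE; have := inv_gt0 s s1; lra.
- by rewrite posrE; have := inv_gt0 s' s'1; lra.
Qed.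

(** * Nearest points *)

Lemma nearest_point_parallel_support {R : realType} {n : nat}
    {O A : set 'rV[R]_n} {x y : 'rV[R]_n} {s : R} :
  convex_set O -> open O -> A `<=` O -> convex_set A -> O x -> ~ A x -> A y ->
  1 < s -> endpoint O x y = Affine (x + s *: (y - x)) ->
  boundary O (x + s *: (y - x)) ->
  (forall t, 0 <= t -> O (x + t *: (y - x)) <-> t < s) ->
  nearest_point O A x y ->
  exists Pi : set 'rV[R]_n, [/\ is_hyperplane Pi, Pi y, separates Pi A x
    & exists (a : 'rV[R]_n) (H : set 'rV[R]_n),
        [/\ endpoint O x y = Affine a, support_hyperplane O H a
          & parallel Pi H]].
Proof.
move=> cO oO AO cA Ox nAx Ay s1 yE bO yO /(nearest_pointP cO oO AO Ox Ay) near_y.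
have xA z : A z -> x != z by move=> Az; apply/eqP => xz; apply: nAx; rewrite xz.
pose B := [set x + s *: (z - x) | z in A].
have cB : convex_set B.
  apply/convex_set_segment => _ _ t [z Az <-] [z' Az' <-] t01.
  exists (z + t *: (z' - z)).
    by move/convex_set_segment : cA; exact.
  by apply/rowP => i; rewrite !mxE; ring.
have OB0 : O `&` B = set0.
  rewrite -subset0 => _ [/[swap] -[z Az <-]] /=.
  have Oz := AO z Az.
  by apply/(funk_le_homothety cO oO Ox Oz (xA y Ay) (xA z Az) s1 yE); exact: near_y.
have Ba : B (x + s *: (y - x)) by exists y.
have [||u u0 uOB] := open_convex_separation oO cO cB _ _ OB0.
- by exists x.
- by eexists; exact: Ba.
have := uOB _ _ Ox Ba; rewrite dot_line => ua.
have uy : dot u y < dot u x by nra.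
(* On B, dot u is largest at the endpoint: were it larger at another point of B,
   some point of O on the segment from x to the endpoint would have the
   same value of dot u as that point. *)
have uA z : A z -> dot u z <= dot u y.
  move=> Az; rewrite leNgt; apply/negP => uyz.
  have Bz : B (x + s *: (z - x)) by exists z.
  have := uOB _ _ Ox Bz; rewrite dot_line => uzx.
  have d0 : 0 < dot u x - dot u y by lra.
  pose t := s * (dot u x - dot u z) / (dot u x - dot u y).
  have Ot : O (x + t *: (y - x)).
    apply/yO; first by rewrite divr_ge0 //; lra.
    by rewrite ltr_pdivrMr //; nra.
  have := uOB _ _ Ot Bz; rewrite !dot_line.
  by rewrite (_ : t * _ = s * (dot u z - dot u x)) ?ltxx // /t; field; lra.
exists (hplane u (dot u y)); split.
- by exists u, (dot u y).
- by [].
- by exists u, (dot u y); split => //; exact: ltW.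
set a := x + s *: (y - x) in yE bO Ba *.
exists a, (hplane u (dot u a)); split=> //.
- split=> //; first by exists u, (dot u a).
  rewrite -subset0 => w [/= uw Ow].
  by have := uOB _ _ Ow Ba; rewrite uw ltxx.
- exists (a - y); apply/seteqP; split=> w /=.
    move=> uw; exists (w - (a - y)); last by rewrite subrK.
    by rewrite /hplane /= !dotBr uw; ring.
  by move=> [v /= uv <-]; rewrite /hplane /= dotDr dotBr uv; ring.
Qed.

Lemma parallel_support_nearest_point {R : realType} {n : nat}
    {O A H Pi : set 'rV[R]_n} {x y : 'rV[R]_n} {s : R} :
  convex_set O -> open O -> A `<=` O -> O x -> ~ A x -> A y ->
  1 < s -> endpoint O x y = Affine (x + s *: (y - x)) ->
  Pi y -> separates Pi A x ->
  support_hyperplane O H (x + s *: (y - x)) -> parallel Pi H ->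
  nearest_point O A x y.
Proof.
move=> cO oO AO Ox nAx Ay s1 yE Piy [u [c [u0 PiE uA ux]]] [_ _ Ha HO0] [v HE].
have xA z : A z -> x != z by move=> Az; apply/eqP => xz; apply: nAx; rewrite xz.
apply/(nearest_pointP cO oO AO Ox Ay) => z Az.
have uy : dot u y = c by move: Piy; rewrite PiE.
pose d := dot u (x + s *: (y - x)).
have dE : d = dot u x + s * (c - dot u x) by rewrite /d dot_line uy.
have uH w : dot u w = d -> H w.
  move=> uw; move: Ha; rewrite HE PiE => -[w0 /= uw0 aE].
  exists (w - v); last by rewrite subrK.
  by rewrite /hplane /= dotBr uw /d -aE dotDr uw0; ring.
have Od w : O w -> dot u w <> d.
  move=> Ow uw; have : (H `&` O) w by split=> //; exact: uH.
  by rewrite HO0.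
have ucx : c < dot u x.
  rewrite lt_neqAle ux andbT; apply/eqP => cx.
  by apply: (Od x Ox); rewrite dE -cx subrr mulr0 addr0.
have uz : dot u z <= c by exact: uA.
apply/(funk_le_homothety cO oO Ox (AO z Az) (xA y Ay) (xA z Az) s1 yE) => Osz.
(* On the segment from x to the image of z, dot u passes from a value above d
   to one that is at most d, so that the segment meets H. *)
have d0 : 0 < s * (dot u x - dot u z) by apply: mulr_gt0; lra.
pose l := (dot u x - d) / (s * (dot u x - dot u z)).
have Ol : O (x + l *: (x + s *: (z - x) - x)).
  move/convex_set_segment : cO; apply => //; apply/andP; split.
    by rewrite divr_ge0 //; [rewrite dE; nra|exact: ltW].
  by rewrite ler_pdivrMr // mul1r dE; nra.
apply: (Od _ Ol); rewrite !dot_line /l; field.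
by rewrite !gt_eqF //; lra.
Qed.

Theorem proposition8p3 (R : realType) (n : nat) (Omega A : set 'rV[R]_n)
    (x y : 'rV[R]_n)
    (Omega_domain : proper_convex_domain Omega)
    (A_sub : A `<=` Omega)
    (A_convex : convex_set A)
    (A_closed : closed (A : set (subspace Omega)))
    (x_Omega : Omega x) (x_notin_A : ~ A x) (y_A : A y) :
  nearest_point Omega A x y <->
  funk Omega x y = 0 \/
  exists Pi : set 'rV[R]_n,
    [/\ is_hyperplane Pi, Pi y, separates Pi A x
      & exists (a : 'rV[R]_n) (H : set 'rV[R]_n),
          [/\ endpoint Omega x y = Affine a,
              support_hyperplane Omega H a & parallel Pi H]].
Proof.
have [_ oO cO _] := Omega_domain.
have Oy := A_sub y y_A.
have xy : x != y by apply/eqP => xy; apply: x_notin_A; rewrite xy.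
have [[yE _]|[s [s1 yE bO yO]]] := endpointP cO oO x_Omega Oy xy.
  have F0 : funk Omega x y = 0 by rewrite /funk (negbTE xy) yE.
  split=> _; first by left.
  apply/(nearest_pointP cO oO A_sub x_Omega y_A) => z Az.
  by rewrite F0 funk_ge0 //; exact: A_sub.
split=> [near_y|[F0|[Pi [_ Piy sep [a [H [aE supp par]]]]]]].
- by right; exact: (nearest_point_parallel_support cO oO A_sub A_convex x_Omega
    x_notin_A y_A s1 yE bO yO near_y).
- apply/(nearest_pointP cO oO A_sub x_Omega y_A) => z Az.
  by rewrite F0 funk_ge0 //; exact: A_sub.
- move: aE; rewrite yE => -[aE]; rewrite -aE in supp.
  exact: (parallel_support_nearest_point cO oO A_sub x_Omega x_notin_A y_A s1 yE
    Piy sep supp par).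
Qed.
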